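(* Let $S$ be a finite generating subset of a group $G$ with $1\in S$ and $|S|<(1-\frac1p)|G|+1$, where $p$ denotes the smallest cardinality of a finite non-null subgroup of $G$ if $G$ is a torsion group, and $p=\infty$ otherwise. Put $\Gamma=\mathrm{Cay}(G,S)$ and assume that $\Gamma$ and $\Gamma^-$ are both degenerate. Then either $S$ is a progression, or there is a finite subgroup $H$ of $G$ with $|H|\ge 2$ such that one of the following holds: (i) $H$ is a $2$-fragment of $\Gamma$ or a $2$-fragment of $\Gamma^-$; (ii) $\Gamma$ and $\Gamma^-$ are $2$-faithful Cauchy graphs and there exists an element $a\in G$ such that $H\cup Ha$ is a $2$-atom of $\Gamma$ or a $2$-atom of $\Gamma^-$.
   Context: A subgroup is non-null if it is not $\{1\}$. A progression is a set of the form $\{a,ra,\dots,r^ja\}$ or $\{a,ar,\dots,ar^j\}$ for some $a,r\in G$, $j\ge0$. $\mathrm{Cay}(G,S)$ is the graph $(G,E)$ with $E=\{(x,y):x^{-1}y\in S\}$, so $\Gamma(X)=XS$; its reverse graph $\Gamma^-$ (edges reversed) is $\mathrm{Cay}(G,S^{-1})$. For a graph $\Gamma=(V,E)$: $\partial(X)=\Gamma(X)\setminus X$, $\nabla(X)=V\setminus\Gamma(X)$; $\Gamma$ is $k$-separable if there is a finite $X$ with $|X|\ge k$, $|\nabla(X)|\ge k$, and then $\kappa_k(\Gamma)=\min\{|\partial(X)|: X\text{ finite},|X|\ge k,|\nabla(X)|\ge k\}$. A $k$-fragment is a finite $X$ with $|X|\ge k$, $|\nabla(X)|\ge k$, $|\partial(X)|=\kappa_k(\Gamma)$;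 a $k$-atom is a $k$-fragment of minimum cardinality. A graph is $k$-faithful if $|A|\le|\nabla(A)|$ for a $k$-atom $A$; a Cauchy graph if it is not $1$-separable or has a $1$-atom $A$ with $|A|=1$ or $|\nabla(A)|=1$; degenerate if it is $2$-separable and $\kappa_2=\kappa_1$. *)

(* Defs.v *)
From HB Require Import structures.
From mathcomp Require Import all_boot all_order all_algebra.
From mathcomp Require Import monoid finmap boolp.

Set Implicit Arguments.
Unset Strict Implicit.
Unset Printing Implicit Defensive.

Local Open Scope fset_scope.
Local Open Scope group_scope.

Section CayleyDefs.
Variable G : groupType.

Definition is_subgroup_pred (H : G -> Prop) : Prop :=
  [/\ H 1, (forall x y, H x -> H y -> H (x * y)) & (forall x, H x -> H x^-1)].

Definition is_fsubgroup (H : {fset G}) : Prop :=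
  is_subgroup_pred (fun x => x \in H).

Definition generates (S : {fset G}) : Prop :=
  forall H : G -> Prop, is_subgroup_pred H ->
    (forall s, s \in S -> H s) -> forall g, H g.

Definition fin_nonnull_subgroup (H : {fset G}) : Prop :=
  is_fsubgroup H /\ H != [fset 1].

Definition torsion : Prop := forall g : G, exists n, (0 < n)%N /\ g ^+ n = 1.

Lemma pmin_ex (h : exists H, fin_nonnull_subgroup H) :
  exists m, `[< exists H, fin_nonnull_subgroup H /\ #|` H| = m >].
Proof. case: h => H hH; exists #|` H|; apply: asboolT; by exists H. Qed.

(* p = smallest cardinality of a finite non-null subgroup when G is torsion
   (Some p), and p = infinity (None) otherwise.  (For the trivial group,
   which has no non-null subgroup, we also put p = infinity.) *)
Definition pmin : option nat :=
  match pselect (torsion /\ exists H, fin_nonnull_subgroup H) with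
  | left h => Some (ex_minn (pmin_ex (proj2 h)))
  | right _ => None
  end.

(* |S| < (1 - 1/p)|G| + 1 ; when G is infinite the right-hand side is
   infinite and the condition holds trivially. *)
Definition size_hyp (S : {fset G}) : Prop :=
  forall E : {fset G}, (forall g : G, g \in E) ->
    match pmin with
    | Some p => ((#|` S|%:R : rat) < (1 - (p%:R)^-1) * #|` E|%:R + 1)%R
    | None => (#|` S| < #|` E| + 1)%N
    end.

Definition progression (S : {fset G}) : Prop :=
  exists (a r : G) (j : nat),
    (forall x, x \in S <-> exists2 i, (i <= j)%N & x = r ^+ i * a) \/
    (forall x, x \in S <-> exists2 i, (i <= j)%N & x = a * r ^+ i).

Definition nbr (S X : {fset G}) : {fset G} := [fset x * s | x in X, s in S].

(* inverse set S^{-1}; Cay(G,S^{-1}) is the reverse graph *)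
Definition invset (S : {fset G}) : {fset G} := [fset s^-1 | s in S].

Definition bd (S X : {fset G}) : {fset G} := nbr S X `\` X.

(* |nabla(X)| >= k, where nabla(X) = G \ Gamma(X) (possibly infinite) *)
Definition nabla_atleast (S X : {fset G}) (k : nat) : Prop :=
  exists Y : {fset G}, (k <= #|` Y|)%N /\ (forall y, y \in Y -> y \notin nbr S X).

Definition nabla_one (S X : {fset G}) : Prop :=
  exists y, y \notin nbr S X /\ forall z, z \notin nbr S X -> z = y.

Definition sep_cond (S : {fset G}) (k : nat) (X : {fset G}) : Prop :=
  (k <= #|` X|)%N /\ nabla_atleast S X k.

Definition separable (S : {fset G}) (k : nat) : Prop :=
  exists X, sep_cond S k X.

Lemma kappa_ex (S : {fset G}) (k : nat) (h : separable S k) :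
  exists m, `[< exists X, sep_cond S k X /\ #|` bd S X| = m >].
Proof. case: h => X hX; exists #|` bd S X|; apply: asboolT; by exists X. Qed.

(* kappa_k = min { |d(X)| : X finite, |X| >= k, |nabla(X)| >= k }
   (only meaningful when the graph is k-separable; 0 otherwise) *)
Definition kappa (S : {fset G}) (k : nat) : nat :=
  match pselect (separable S k) with
  | left h => ex_minn (kappa_ex h)
  | right _ => 0
  end.

Definition fragment (S : {fset G}) (k : nat) (X : {fset G}) : Prop :=
  sep_cond S k X /\ #|` bd S X| = kappa S k.

Definition atom (S : {fset G}) (k : nat) (A : {fset G}) : Prop :=
  fragment S k A /\ forall X, fragment S k X -> (#|` A| <= #|` X|)%N.

Definition faithful (S : {fset G}) (k : nat) : Prop :=
  exists A, atom S k A /\ nabla_atleast S A #|` A|.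

Definition cauchy (S : {fset G}) : Prop :=
  ~ separable S 1 \/
  exists A, atom S 1 A /\ (#|` A| = 1%N \/ nabla_one S A).

Definition degenerate (S : {fset G}) : Prop :=
  separable S 2 /\ kappa S 2 = kappa S 1.

Definition coset_union (H : {fset G}) (a : G) : {fset G} :=
  H `|` [fset h * a | h in H].

End CayleyDefs.

(* Main.v *)
(* Write k for kappa_1 = kappa_2.  By submodularity of |XS|, two 2-fragments of
   Gamma that meet have a union and an intersection of boundary at most k, as
   long as the union does not dominate G.  If Gamma^- is not 2-faithful, the
   complements of its 2-atoms are 2-fragments of Gamma of maximal size, too
   small for the union of two of them to dominate G; so they are blocks, that
   is, left cosets of a subgroup.  If both graphs are 2-faithful and
   k < |S| - 1, the 2-atoms themselves are blocks.

   Otherwise k = |S| - 1 for both graphs; let M and N be 2-atoms of Gamma and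
   Gamma^-.  A 2-atom {x, y} makes S periodic under r = x^-1 y up to one hole,
   so that S is a progression or <r> is a 2-fragment.  If some point of M is on
   at most two left translates of M, then M is a translate of some H U Ha.
   If none of these cases occurs, and |M| <= |N| say, every translate of N that
   meets MS meets all the sets xS for x in M; hence N S^-1, and then S^-1 as an
   intersection of two translates of N S^-1, has a right period u <> 1, and
   the set {1, u^-1} violates k = |S| - 1. *)
From mathcomp Require Import fingroup pgroup.
Require Import Defs.
From HB Require Import structures.
From mathcomp Require Import all_boot all_order all_algebra.
From mathcomp Require Import monoid finmap boolp.
From mathcomp Require Import zify lra.

Set Implicit Arguments.
Unset Strict Implicit.

Local Open Scope fset_scope.
Local Open Scope group_scope.

(* [lia] compares its atoms up to conversion, which explodes on cardinals of
   [fset] expressions; they are therefore turned into variables first. *)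
Ltac card_lia :=
  repeat match goal with
  | H : forall _, _ |- _ => clear H
  | H : is_true (in_mem _ _) |- _ => clear H
  | H : is_true (~~ _) |- _ => clear H
  | H : is_true (fsubset _ _) |- _ => clear H
  | H : context [size (enum_fset ?X)] |- _ =>
      let n := fresh "n" in set (n := size (enum_fset X)) in *; clearbody n
  | |- context [size (enum_fset ?X)] =>
      let n := fresh "n" in set (n := size (enum_fset X)) in *; clearbody n
  | H : context [kappa ?S ?k] |- _ =>
      let n := fresh "n" in set (n := kappa S k) in *; clearbody n
  end; lia.

(** * Left translates, reversal and neighbourhoods *)

Definition ltrans (G : groupType) (g : G) (X : {fset G}) : {fset G} :=
  [fset g * x | x in X].

Lemma in_ltrans (G : groupType) (g : G) (X : {fset G}) y :
  (y \in ltrans g X) = (g^-1 * y \in X).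
Proof.
apply/imfsetP/idP => [[x /= Xx ->]|Xy]; first by rewrite mulKg.
by exists (g^-1 * y) => //=; rewrite mulVKg.
Qed.

Lemma card_ltrans (G : groupType) (g : G) (X : {fset G}) :
  #|` ltrans g X| = #|` X|.
Proof. by rewrite card_imfset //; exact: mulgI. Qed.

Lemma in_invset (G : groupType) (S : {fset G}) y :
  (y \in invset S) = (y^-1 \in S).
Proof.
apply/imfsetP/idP => [[x /= Sx ->]|Sy]; first by rewrite invgK.
by exists y^-1; rewrite ?invgK.
Qed.

Lemma invsetK (G : groupType) (S : {fset G}) : invset (invset S) = S.
Proof. by apply/fsetP => y; rewrite !in_invset invgK. Qed.

Lemma card_invset (G : groupType) (S : {fset G}) : #|` invset S| = #|` S|.
Proof. by rewrite card_imfset //; exact: invg_inj. Qed.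

Lemma nbrP (G : groupType) (S X : {fset G}) y :
  y \in nbr S X <-> exists2 x, x \in X & x^-1 * y \in S.
Proof.
split=> [/imfset2P[x /= Xx [s /= Ss ->]]|[x Xx Sxy]].
  by exists x => //; rewrite mulKg.
by apply/imfset2P; exists x => //; exists (x^-1 * y) => //=; rewrite mulVKg.
Qed.

Lemma nbr_invP (G : groupType) (S X : {fset G}) y :
  y \in nbr (invset S) X <-> exists2 x, x \in X & y^-1 * x \in S.
Proof.
by split=> [/nbrP|] [x Xx]; rewrite ?in_invset ?invgM ?invgK => Sxy;
  [exists x | apply/nbrP; exists x; rewrite ?in_invset ?invgM ?invgK].
Qed.

Lemma nbr_ltrans (G : groupType) (S X : {fset G}) g :
  nbr S (ltrans g X) = ltrans g (nbr S X).
Proof.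
apply/fsetP => y; apply/idP/idP; rewrite in_ltrans.
  case/nbrP=> x; rewrite in_ltrans => Xx Sxy; apply/nbrP.
  by exists (g^-1 * x); rewrite // invgM invgK -mulgA mulVKg.
case/nbrP=> x Xx Sxy; apply/nbrP; exists (g * x).
  by rewrite in_ltrans mulKg.
by rewrite invgM -mulgA.
Qed.

Lemma nbr_fset1 (G : groupType) (S : {fset G}) x : nbr S [fset x] = ltrans x S.
Proof.
apply/fsetP => y; rewrite in_ltrans; apply/idP/idP.
  by case/nbrP=> z /fset1P ->.
by move=> Sxy; apply/nbrP; exists x; rewrite ?in_fset1.
Qed.

Lemma nbrS (G : groupType) (S X Y : {fset G}) :
  X `<=` Y -> nbr S X `<=` nbr S Y.
Proof.
move=> /fsubsetP sXY; apply/fsubsetP => y /nbrP[x /sXY Yx Sxy].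
by apply/nbrP; exists x.
Qed.

Lemma nbrU (G : groupType) (S X Y : {fset G}) :
  nbr S (X `|` Y) = nbr S X `|` nbr S Y.
Proof.
apply/fsetP => y; rewrite in_fsetU; apply/idP/orP.
  by case/nbrP=> x /fsetUP[] ? ?; [left|right]; apply/nbrP; exists x.
by case; apply/fsubsetP/nbrS; rewrite ?fsubsetUl ?fsubsetUr.
Qed.

Lemma sub_nbr (G : groupType) (S X : {fset G}) : 1 \in S -> X `<=` nbr S X.
Proof.
by move=> S1; apply/fsubsetP => x Xx; apply/nbrP; exists x; rewrite ?mulVg.
Qed.

Lemma card_nbr (G : groupType) (S X : {fset G}) :
  1 \in S -> #|` nbr S X| = (#|` X| + #|` bd S X|)%N.
Proof.
move=> S1; rewrite /bd cardfsDS ?sub_nbr // subnKC //.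
exact/fsubset_leq_card/sub_nbr.
Qed.

Lemma nbrI_sub (G : groupType) (S X Y : {fset G}) :
  nbr S (X `&` Y) `<=` nbr S X `&` nbr S Y.
Proof. by rewrite fsubsetI !nbrS ?fsubsetIl ?fsubsetIr. Qed.

Lemma card_nbr_submod (G : groupType) (S X Y : {fset G}) :
  (#|` nbr S (X `&` Y)| + #|` nbr S (X `|` Y)| <=
   #|` nbr S X| + #|` nbr S Y|)%N.
Proof.
rewrite -(cardfsUI (nbr S X)) nbrU addnC leq_add2l.
exact/fsubset_leq_card/nbrI_sub.
Qed.

Lemma nabla_atleastS (G : groupType) (S X Y : {fset G}) k l :
  X `<=` Y -> (l <= k)%N -> nabla_atleast S Y k -> nabla_atleast S X l.
Proof.
move=> sXY lk [Z [kZ ZY]]; exists Z; split; first exact: leq_trans kZ.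
move=> z /ZY; apply: contra; exact/fsubsetP/nbrS.
Qed.

Lemma nabla_atleast_ltrans (G : groupType) (S X : {fset G}) g k :
  nabla_atleast S X k -> nabla_atleast S (ltrans g X) k.
Proof.
case=> Z [kZ ZX]; exists (ltrans g Z); rewrite card_ltrans; split=> // y.
by rewrite nbr_ltrans !in_ltrans => /ZX.
Qed.

Lemma sep_cond_ltrans (G : groupType) (S X : {fset G}) g k :
  sep_cond S k X -> sep_cond S k (ltrans g X).
Proof.
by case=> kX nX; split; rewrite ?card_ltrans //; exact: nabla_atleast_ltrans.
Qed.

Lemma card_bd_ltrans (G : groupType) (S X : {fset G}) g :
  #|` bd S (ltrans g X)| = #|` bd S X|.
Proof.
rewrite -(card_ltrans g (bd S X)) /bd nbr_ltrans.
suff -> : ltrans g (nbr S X `\` X) = ltrans g (nbr S X) `\` ltrans g X by [].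
by apply/fsetP => y; rewrite in_fsetD !in_ltrans in_fsetD.
Qed.

Lemma fragment_ltrans (G : groupType) (S X : {fset G}) g k :
  fragment S k X -> fragment S k (ltrans g X).
Proof.
by case=> sX kX; split; [exact: sep_cond_ltrans | rewrite card_bd_ltrans].
Qed.

Lemma atom_ltrans (G : groupType) (S A : {fset G}) g k :
  atom S k A -> atom S k (ltrans g A).
Proof.
by case=> fA mA; split; [exact: fragment_ltrans | rewrite card_ltrans].
Qed.

(** * Minimal boundaries, fragments and atoms *)

Lemma kappa_min (G : groupType) (S X : {fset G}) k :
  sep_cond S k X -> (kappa S k <= #|` bd S X|)%N.
Proof.
move=> sX; rewrite /kappa; case: pselect => [h|h]; last by case: h; exists X.
by case: ex_minnP => m _ mP; apply: mP; apply/asboolP; exists X.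
Qed.

Lemma fragment_exists (G : groupType) (S : {fset G}) k :
  separable S k -> exists X, fragment S k X.
Proof.
move=> h; rewrite /fragment /kappa; case: pselect => // h'.
by case: ex_minnP => m /asboolP[X [sX <-]] _; exists X.
Qed.

Lemma atom_exists (G : groupType) (S : {fset G}) k :
  separable S k -> exists A, atom S k A.
Proof.
move=> /fragment_exists[X fX].
have ex : exists m, `[< exists A, fragment S k A /\ #|` A| = m >].
  by exists #|` X|; apply/asboolP; exists X.
case: (ex_minnP ex) => m /asboolP[A [fA <-]] mA; exists A; split=> // Y fY.
by apply: mA; apply/asboolP; exists Y.
Qed.

Lemma kappa1_le (G : groupType) (S X : {fset G}) x y :
  1 \in S -> x \in X -> y \notin nbr S X ->
  (#|` X| + kappa S 1 <= #|` nbr S X|)%N.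
Proof.
move=> S1 Xx yX; rewrite card_nbr // leq_add2l; apply: kappa_min; split.
  by rewrite cardfs_gt0; apply/fset0Pn; exists x.
by exists [fset y]; rewrite cardfs1; split=> // z /fset1P ->.
Qed.

(** Since $\kappa_2=\kappa_1$, a 2-fragment can be recognised by comparison with [kappa1_le], whose
    lower bound needs only one point in X and one point off XS. *)
Lemma degenerate_fragment (G : groupType) (S X : {fset G}) :
  1 \in S -> degenerate S -> (2 <= #|` X|)%N -> nabla_atleast S X 2 ->
  (#|` nbr S X| <= #|` X| + kappa S 1)%N -> fragment S 2 X.
Proof.
move=> S1 [_ eqk] X2 nX; rewrite card_nbr // leq_add2l => leX.
split=> //; apply/eqP; rewrite eqn_leq {1}eqk leX.
exact: kappa_min.
Qed.

Lemma fragment_nbr (G : groupType) (S X : {fset G}) :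
  1 \in S -> degenerate S -> fragment S 2 X ->
  #|` nbr S X| = (#|` X| + kappa S 1)%N.
Proof. by move=> S1 [_ <-] [_ <-]; exact: card_nbr. Qed.

Lemma nabla_atleastP (G : groupType) (S X : {fset G}) k :
  nabla_atleast S X k -> (0 < k)%N -> exists y, y \notin nbr S X.
Proof.
move=> [Y [kY nY]] k0.
have /fset0Pn[y Yy] : Y != fset0 by rewrite -cardfs_gt0 (leq_trans k0).
by exists y; exact: nY.
Qed.

(** * Blocks of left translation and subgroups *)

Lemma stable_subgroup (G : groupType) (H : {fset G}) :
  1 \in H -> (forall h, h \in H -> ltrans h H = H) -> is_fsubgroup H.
Proof.
move=> H1 stH; split=> // [x y Hx Hy|x Hx].
  by rewrite -(stH x Hx) in_ltrans mulKg.
by rewrite -(mulg1 x^-1) -in_ltrans stH.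
Qed.

(** If x and xh lie in A, then $g=xhx^{-1}$ sends x to xh, so A meets gA and equals it. Hence h
    stabilises $x^{-1}A$, which is therefore a subgroup; as a translate of A it is still a
    fragment. *)
Lemma fragment_block (G : groupType) (S A : {fset G}) :
  fragment S 2 A ->
  (forall g, A `&` ltrans g A != fset0 -> ltrans g A = A) ->
  exists H : {fset G}, [/\ is_fsubgroup H, (2 <= #|` H|)%N & fragment S 2 H].
Proof.
move=> fA blockA; have [[A2 _] _] := fA.
have /fset0Pn[x Ax] : A != fset0 by rewrite -cardfs_gt0 (leq_trans _ A2).
exists (ltrans x^-1 A); rewrite card_ltrans; split=> //.
  apply: stable_subgroup => [|h]; rewrite in_ltrans invgK ?mulg1 // => Axh.
  have Ah : ltrans (x * h * x^-1) A = A.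
    apply: blockA; apply/fset0Pn; exists (x * h).
    by rewrite in_fsetI Axh in_ltrans !invgM !invgK -!mulgA mulKg mulVg mulg1.
  rewrite -[in RHS]Ah; apply/fsetP => y; rewrite !in_ltrans !invgM !invgK.
  by rewrite -!mulgA mulKg.
exact: fragment_ltrans.
Qed.

(** * Complements in a finite group, and the case where the reverse graph is not 2-faithful *)

Lemma infinite_avoid (G : groupType) (X : {fset G}) k :
  ~ (exists E : {fset G}, forall g, g \in E) ->
  exists Y : {fset G}, #|` Y| = k /\ forall y, y \in Y -> y \notin X.
Proof.
move=> infG; elim: k => [|k [Y [cY nY]]].
  by exists fset0; rewrite cardfs0.
have [g] : exists g, g \notin X `|` Y.
  apply: contrapT => full; apply: infG; exists (X `|` Y) => g.
  by apply/negPn/negP => gXY; apply: full; exists g.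
rewrite in_fsetU negb_or => /andP[gX gY]; exists (g |` Y).
by rewrite cardfsU1 gY cY; split=> // y /fset1UP[-> // | /nY].
Qed.

Lemma card_setC (G : groupType) (E X : {fset G}) :
  (forall g, g \in E) -> #|` E `\` X| = (#|` E| - #|` X|)%N.
Proof. by move=> fullE; rewrite cardfsDS //; apply/fsubsetP => x _. Qed.

Lemma leq_card_full (G : groupType) (E X : {fset G}) :
  (forall g, g \in E) -> (#|` X| <= #|` E|)%N.
Proof. by move=> fullE; apply/fsubset_leq_card/fsubsetP => x _. Qed.

Lemma nbr_dual_disjoint (G : groupType) (S E X : {fset G}) x :
  x \in X -> x \notin nbr (invset S) (E `\` nbr S X).
Proof.
move=> Xx; apply/negP => /nbr_invP[z]; rewrite in_fsetD => /andP[/negP nz _].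
by move=> Sxz; apply: nz; apply/nbrP; exists x.
Qed.

Lemma card_nbr_dual (G : groupType) (S E X : {fset G}) :
  (forall g, g \in E) ->
  (#|` nbr (invset S) (E `\` nbr S X)| + #|` X| <= #|` E|)%N.
Proof.
move=> fullE.
have : nbr (invset S) (E `\` nbr S X) `<=` E `\` X.
  apply/fsubsetP => x xD; rewrite in_fsetD fullE andbT.
  by apply: contraL xD; exact: nbr_dual_disjoint.
move/fsubset_leq_card; rewrite (card_setC X) //.
by have := leq_card_full X fullE; card_lia.
Qed.

Lemma sep_cond_dual (G : groupType) (S E X : {fset G}) k :
  (forall g, g \in E) -> sep_cond S k X ->
  sep_cond (invset S) k (E `\` nbr S X).
Proof.
move=> fullE [kX [Y [kY nY]]]; split.
  apply: leq_trans kY _; apply/fsubset_leq_card/fsubsetP => y /nY ny.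
  by rewrite in_fsetD ny fullE.
by exists X; split=> // y; exact: nbr_dual_disjoint.
Qed.

(** In the reverse graph the boundary of E \ XS avoids both E \ XS and X, so it lies in [bd S X].
    This is applied to an X of minimal boundary. *)
Lemma kappa_dual (G : groupType) (S E : {fset G}) k :
  (forall g, g \in E) -> 1 \in S -> separable S k ->
  (kappa (invset S) k <= kappa S k)%N.
Proof.
move=> fullE S1 /fragment_exists[X [sX <-]].
have S1' : 1 \in invset S by rewrite in_invset invg1.
apply: leq_trans (kappa_min (sep_cond_dual fullE sX)) _.
have := card_nbr_dual S X fullE; rewrite !card_nbr // card_setC // card_nbr //.
by have := leq_card_full (nbr S X) fullE; rewrite card_nbr //; card_lia.
Qed.

Lemma not_faithful_subgroup (G : groupType) (S : {fset G}) :
  1 \in S -> degenerate S -> degenerate (invset S) ->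
  ~ faithful (invset S) 2 ->
  exists H : {fset G}, [/\ is_fsubgroup H, (2 <= #|` H|)%N & fragment S 2 H].
Proof.
move=> S1 dS dS' nf; have S1' : 1 \in invset S by rewrite in_invset invg1.
have [N aN] := atom_exists (proj1 dS').
have nN : ~ nabla_atleast (invset S) N #|` N| by move=> h; apply: nf; exists N.
(* In an infinite group every finite set misses arbitrarily many vertices, so failure of
   faithfulness forces G to be finite. *)
have [E fullE] : exists E : {fset G}, forall g, g \in E.
  apply: contrapT => infG; apply: nN.
  have [Y [cY nY]] := infinite_avoid (nbr (invset S) N) #|` N| infG.
  by exists Y; rewrite cY.
have eqk : kappa S 1 = kappa (invset S) 1.
  have le1 := kappa_dual fullE S1 (proj1 dS).
  have le2 := kappa_dual fullE S1' (proj1 dS').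
  rewrite invsetK in le2; rewrite -(proj2 dS) -(proj2 dS'); card_lia.
have [fN mN] := aN; have [sN _] := fN.
pose F := E `\` nbr (invset S) N.
have FN : (#|` F| < #|` N|)%N.
  rewrite ltnNge; apply/negP => leNF; apply: nN; exists F; split=> // y.
  by rewrite in_fsetD => /andP[].
have cN := fragment_nbr S1' dS' fN.
have [F2 nF] : sep_cond S 2 F.
  by rewrite -(invsetK S); exact: sep_cond_dual.
have cFS : (#|` nbr S F| + #|` N| <= #|` E|)%N.
  by rewrite -{1}(invsetK S); exact: card_nbr_dual.
have cF : (#|` F| + #|` N| + kappa S 1 = #|` E|)%N.
  have := leq_card_full (nbr (invset S) N) fullE.
  by rewrite /F card_setC // cN eqk; card_lia.
have fF : fragment S 2 F.
  by apply: degenerate_fragment => //; card_lia.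
(* The complement of XS is a 2-fragment of the reverse graph, hence has at least |N| elements;
   complementing turns minimality of N into maximality of F. *)
have maxF X : fragment S 2 X -> (#|` X| <= #|` F|)%N.
  move=> fX; have [sX _] := fX; have cX := fragment_nbr S1 dS fX.
  have leX := leq_card_full (nbr S X) fullE.
  have cD := card_setC (nbr S X) fullE.
  have cD' := card_nbr_dual S X fullE.
  have [D2 nD] := sep_cond_dual fullE sX.
  have /mN : fragment (invset S) 2 (E `\` nbr S X).
    by apply: degenerate_fragment => //; card_lia.
  card_lia.
apply: (fragment_block fF) => g /fset0Pn[x FFx].
set F' := ltrans g F; have cF' : #|` F'| = #|` F| by exact: card_ltrans.
have cF'S : #|` nbr S F'| = #|` nbr S F| by rewrite /F' nbr_ltrans card_ltrans.
have [y ny] := nabla_atleastP nF isT.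
have leI : (#|` F `&` F'| + kappa S 1 <= #|` nbr S (F `&` F')|)%N.
  apply: (@kappa1_le _ _ _ _ y S1 FFx); apply: contra ny.
  by by apply: (fsubsetP (nbrS S (fsubsetIl F F'))).
have I1 : (0 < #|` F `&` F'|)%N by rewrite cardfs_gt0; apply/fset0Pn; exists x.
have sub := card_nbr_submod S F F'; have UI := cardfsUI F F'.
have cEU := card_setC (nbr S (F `|` F')) fullE.
have leF := fsubset_leq_card (fsubsetUl F F').
(* Submodularity bounds the boundary of the union by $\kappa_1$. As the union has at most 2|F| - 1
   elements and |E| = |F| + |N| + $\kappa_1$, its neighbourhood misses at least |N| - |F| + 1
   points, which is at least 2 because |F| < |N|. *)
have fU : fragment S 2 (F `|` F').
  apply: degenerate_fragment => //; [card_lia| |card_lia].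
  exists (E `\` nbr S (F `|` F')); split=> [|z]; first by card_lia.
  by rewrite in_fsetD => /andP[].
have eqU : F = F `|` F'.
  by apply/eqP; rewrite eqEfcard fsubsetUl maxF.
apply/eqP; rewrite eqEfcard cF' leqnn andbT [X in _ `<=` X]eqU.
exact: fsubsetUr.
Qed.

(** * Intersections of 2-atoms of one graph *)

Lemma separable_proper (G : groupType) (S : {fset G}) k :
  separable S k.+1 -> exists y, y \notin S.
Proof.
move=> [X [X1 /nabla_atleastP[//|y ny]]].
have /fset0Pn[x Xx] : X != fset0 by rewrite -cardfs_gt0 (leq_trans _ X1).
by exists (x^-1 * y); apply: contra ny => Sxy; apply/nbrP; exists x.
Qed.

Lemma kappa1_card (G : groupType) (S : {fset G}) k :
  1 \in S -> separable S k.+1 -> (kappa S 1 < #|` S|)%N.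
Proof.
move=> S1 /separable_proper[y ny].
have n1y : y \notin nbr S [fset 1].
  by rewrite nbr_fset1 in_ltrans invg1 mul1g.
have := kappa1_le S1 (fset11 1) n1y.
by rewrite nbr_fset1 card_ltrans cardfs1.
Qed.

(** Shrinking a set only enlarges its nabla, so X is a 2-fragment, and minimality of M leaves no
    room for a proper subset. *)
Lemma sub_atom (G : groupType) (S M X : {fset G}) :
  1 \in S -> degenerate S -> atom S 2 M -> X `<=` M -> (2 <= #|` X|)%N ->
  (#|` nbr S X| <= #|` X| + kappa S 1)%N -> X = M.
Proof.
move=> S1 dS [fM mM] sXM X2 leX; apply/eqP; rewrite eqEfcard sXM mM //.
apply: degenerate_fragment => //.
by have [[_ nM] _] := fM; exact: nabla_atleastS nM.
Qed.

Lemma eq_atoms (G : groupType) (S M M' : {fset G}) :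
  atom S 2 M -> atom S 2 M' -> M `&` M' = M -> M = M'.
Proof.
move=> [fM _] [_ mM'] /fsetIidPl sMM'.
by apply/eqP; rewrite eqEfcard sMM' mM'.
Qed.

(* If [(M U M')S] were all of G, the nabla of M would lie in [M'S \ MS], which
   has fewer than #|M| elements. *)
Lemma atomsU_nabla (G : groupType) (S M M' : {fset G}) x :
  1 \in S -> degenerate S -> atom S 2 M -> atom S 2 M' ->
  nabla_atleast S M #|` M| -> x \in M -> x \in M' ->
  exists y, y \notin nbr S (M `|` M').
Proof.
move=> S1 dS [fM mM] [fM' mM'] [Y [MY nY]] Mx M'x; apply: contrapT => full.
have sY : Y `<=` nbr S M' `\` nbr S M.
  apply/fsubsetP => y /nY ny; rewrite in_fsetD ny /=.
  apply/negPn/negP => ny'; apply: full; exists y.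
  by rewrite nbrU in_fsetU negb_or ny.
have := fsubset_leq_card sY; have := cardfsID (nbr S M) (nbr S M').
have cM := mM _ fM'; have cM' := mM' _ fM.
have kM' := fragment_nbr S1 dS fM'; have [[_ nM] _] := fM.
have [y ny] := nabla_atleastP nM isT.
have xI : x \in M' `&` M by rewrite in_fsetI M'x.
have nyI : y \notin nbr S (M' `&` M).
  by apply: contra ny; apply/fsubsetP/nbrS/fsubsetIr.
have := kappa1_le S1 xI nyI.
have := fsubset_leq_card (nbrI_sub S M' M).
have : (0 < #|` M' `&` M|)%N by rewrite cardfs_gt0; apply/fset0Pn; exists x.
card_lia.
Qed.

(** Inclusion-exclusion turns the lower bound for the neighbourhood of the union into an upper
    bound. It is stated for the intersection of MS and M'S, which contains the neighbourhood of the
    intersection of M and M', so that the former can later be identified exactly. *)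
Lemma atoms_meet (G : groupType) (S M M' : {fset G}) x :
  1 \in S -> degenerate S -> atom S 2 M -> atom S 2 M' ->
  nabla_atleast S M #|` M| -> x \in M -> x \in M' ->
  (#|` nbr S M `&` nbr S M'| <= #|` M `&` M'| + kappa S 1)%N.
Proof.
move=> S1 dS aM aM' nM Mx M'x.
have [y ny] := atomsU_nabla S1 dS aM aM' nM Mx M'x.
have xU : x \in M `|` M' by rewrite in_fsetU Mx.
have := kappa1_le S1 xU ny; rewrite nbrU.
have := cardfsUI (nbr S M) (nbr S M'); have := cardfsUI M M'.
rewrite (fragment_nbr S1 dS (proj1 aM)) (fragment_nbr S1 dS (proj1 aM')).
card_lia.
Qed.

(** Two translates of M cannot share exactly one point x: xS has |S| elements and would lie in a set
    of at most $1+\kappa_1$ elements. Sharing two points, they coincide by [sub_atom]. *)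
Lemma small_kappa_subgroup (G : groupType) (S : {fset G}) :
  1 \in S -> degenerate S -> faithful S 2 -> ((kappa S 1).+1 < #|` S|)%N ->
  exists H : {fset G}, [/\ is_fsubgroup H, (2 <= #|` H|)%N & fragment S 2 H].
Proof.
move=> S1 dS [M [aM nM]] ltk; apply: (fragment_block (proj1 aM)) => g.
case/fset0Pn=> x xI; have := xI; rewrite in_fsetI => /andP[Mx M'x].
have aM' := atom_ltrans g aM; apply/esym; apply: (eq_atoms aM aM').
have le1 := atoms_meet S1 dS aM aM' nM Mx M'x.
have le2 := fsubset_leq_card (nbrI_sub S M (ltrans g M)).
apply: (sub_atom S1 dS aM); rewrite ?fsubsetIl //; last exact: leq_trans le1.
rewrite ltnNge; apply/negP => I1.
have /fsubset_leq_card : nbr S [fset x] `<=` nbr S (M `&` ltrans g M).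
  by rewrite nbrS // fsub1set.
rewrite nbr_fset1 card_ltrans; card_lia.
Qed.

(** Two common points would make the atoms equal. With a single one, the intersection of MS and M'S
    has at most $1+\kappa_1=|S|$ elements and contains xS. *)
Lemma distinct_atoms_meet (G : groupType) (S M M' : {fset G}) x :
  1 \in S -> degenerate S -> (kappa S 1).+1 = #|` S| ->
  atom S 2 M -> atom S 2 M' -> nabla_atleast S M #|` M| ->
  x \in M -> x \in M' -> M != M' ->
  M `&` M' = [fset x] /\ nbr S M `&` nbr S M' = ltrans x S.
Proof.
move=> S1 dS kS aM aM' nM Mx M'x neM.
have le1 := atoms_meet S1 dS aM aM' nM Mx M'x.
have le2 := fsubset_leq_card (nbrI_sub S M M').
have sx : [fset x] `<=` M `&` M' by rewrite fsub1set in_fsetI Mx.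
have I1 : (#|` M `&` M'| <= 1)%N.
  rewrite leqNgt; apply: contra neM => I2; apply/eqP/(eq_atoms aM aM').
  apply: (sub_atom S1 dS aM); rewrite ?fsubsetIl //; exact: leq_trans le1.
have eqI : [fset x] = M `&` M' by apply/eqP; rewrite eqEfcard sx cardfs1.
split=> //; apply/esym/eqP; rewrite eqEfcard card_ltrans.
rewrite -nbr_fset1 {1}eqI nbrI_sub /= -kS -add1n.
by apply: leq_trans le1 _; rewrite leq_add2r.
Qed.

(** * A 2-atom of the graph against a 2-atom of its reverse *)

(** Let A and B be the parts of M and N outside each other's neighbourhoods. Then AS avoids N and
    $BS^{-1}$ avoids M. The lower bound for $BS^{-1}$, fed into the resulting upper bound for AS,
    gives $|AS|\le|A|+\kappa_1$. If A had two points, minimality would give A = M, against z. *)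
Lemma cross_meet (G : groupType) (S M N : {fset G}) x y z :
  1 \in S -> degenerate S -> degenerate (invset S) ->
  kappa S 1 = kappa (invset S) 1 ->
  atom S 2 M -> fragment (invset S) 2 N ->
  x \in M -> x \notin nbr (invset S) N ->
  y \in N -> y \notin nbr S M ->
  z \in M -> z \in nbr (invset S) N ->
  #|` M `\` nbr (invset S) N| = 1%N.
Proof.
move=> S1 dS dS' eqk aM fN Mx nx Ny ny Mz xz.
have S1' : 1 \in invset S by rewrite in_invset invg1.
have [fM mM] := aM; have cM := fragment_nbr S1 dS fM.
have cN := fragment_nbr S1' dS' fN.
have [[_ nM] _] := fM; have [[_ nN] _] := fN.
have [u nu] := nabla_atleastP nM isT; have [v nv] := nabla_atleastP nN isT.
set A := M `\` _; set B := N `\` nbr S M.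
have Ax : x \in A by rewrite in_fsetD nx.
have By : y \in B by rewrite in_fsetD ny.
have uA : u \notin nbr S A.
  by apply: contra nu; apply/fsubsetP/nbrS/fsubsetDl.
have vB : v \notin nbr (invset S) B.
  by apply: contra nv; apply/fsubsetP/nbrS/fsubsetDl.
have leA := kappa1_le S1 Ax uA; have leB := kappa1_le S1' By vB.
have sA : nbr S A `<=` nbr S M `\` N.
  apply/fsubsetP => t /nbrP[a]; rewrite !in_fsetD => /andP[/negP na Ma] Sat.
  apply/andP; split; last by apply/nbrP; exists a.
  by apply/negP => Nt; apply: na; apply/nbr_invP; exists t.
have sB : nbr (invset S) B `<=` nbr (invset S) N `\` M.
  apply/fsubsetP => t /nbr_invP[b]; rewrite !in_fsetD => /andP[/negP nb Nb] Sat.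
  apply/andP; split; last by apply/nbr_invP; exists b.
  by apply/negP => Mt; apply: nb; apply/nbrP; exists t.
have := fsubset_leq_card sA; have := fsubset_leq_card sB => leB' leA'.
have e1 := cardfsID N (nbr S M); have e2 := cardfsID M (nbr (invset S) N).
have e3 := cardfsID (nbr S M) N; have e4 := cardfsID (nbr (invset S) N) M.
rewrite (fsetIC N) -/B in e3; rewrite (fsetIC M) -/A in e4.
have A1 : (0 < #|` A|)%N by rewrite cardfs_gt0; apply/fset0Pn; exists x.
have [A2|A2] := leqP #|` A| 1%N.
  by apply/eqP; rewrite eqn_leq A2 A1.
have eA : A = M.
  by apply: (@sub_atom _ S M A S1 dS aM (fsubsetDl _ _) A2); card_lia.
by have := Mz; rewrite -eA in_fsetD xz.
Qed.

Definition two_other_translates (G : groupType) (M : {fset G}) : Prop :=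
  forall x, x \in M -> exists g1 g2 : G,
    [/\ x \in ltrans g1 M, x \in ltrans g2 M, M != ltrans g1 M,
        M != ltrans g2 M & ltrans g1 M != ltrans g2 M].

(* Were [x] missing from [N S^-1], [cross_meet] would force #|M| = #|N| and
   [M \ x = N S^-1 \ w S^-1] for some w in N.  One of the two other translates
   M' of M through c avoids w in [M'S]; then M' meets [N S^-1] in c only,
   which [cross_meet] forbids. *)
Lemma atoms_meet_all (G : groupType) (S M N : {fset G}) x z :
  1 \in S -> degenerate S -> degenerate (invset S) ->
  (kappa S 1).+1 = #|` S| -> (kappa (invset S) 1).+1 = #|` S| ->
  atom S 2 M -> nabla_atleast S M #|` M| -> atom (invset S) 2 N ->
  (2 < #|` M|)%N -> (#|` M| <= #|` N|)%N -> two_other_translates M ->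
  x \in M -> z \in N -> z \in nbr S M -> x \in nbr (invset S) N.
Proof.
move=> S1 dS dS' kS kS' aM nM aN M3 leMN tM Mx Nz Mz.
have S1' : 1 \in invset S by rewrite in_invset invg1.
have eqk : kappa S 1 = kappa (invset S) 1 by apply: succn_inj; rewrite kS.
have cM := fragment_nbr S1 dS (proj1 aM).
have cN := fragment_nbr S1' dS' (proj1 aN).
apply/negPn/negP => nx; have [c Mc Scz] := (nbrP _ _ _).1 Mz.
have Nc : c \in nbr (invset S) N by apply/nbr_invP; exists z.
have sxM : ltrans x S `<=` nbr S M.
  by rewrite -nbr_fset1 nbrS // fsub1set.
have cx : #|` nbr S M `\` ltrans x S| = #|` M|.-1.
  by rewrite cardfsDS // card_ltrans cM; card_lia.
have disj y : y \in N -> y \notin ltrans x S.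
  move=> Ny; rewrite in_ltrans; apply: contra nx => Sxy.
  by apply/nbr_invP; exists y.
(* N avoids xS, so its part inside MS has at most |M| - 1 < |N| elements. *)
have [w Nw nw] : exists2 w, w \in N & w \notin nbr S M.
  apply: contrapT => sNM.
  have : N `<=` nbr S M `\` ltrans x S.
    apply/fsubsetP => y Ny; rewrite in_fsetD disj //=.
    by apply/negPn/negP => ny; apply: sNM; exists y.
  by move/fsubset_leq_card; rewrite cx; card_lia.
have card1M := cross_meet S1 dS dS' eqk aM (proj1 aN) Mx nx Nw nw Mc Nc.
have card1N : #|` N `\` nbr S M| = 1%N.
  have := @cross_meet _ (invset S) N M w x z; rewrite invsetK; apply=> //.
  by case: aM.
have leNM : (#|` nbr S M `&` N| <= #|` M|.-1)%N.
  rewrite -cx; apply/fsubset_leq_card/fsubsetP => y; rewrite in_fsetI in_fsetD.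
  by case/andP=> -> /disj ->.
have wN : ltrans w (invset S) `<=` nbr (invset S) N.
  by rewrite -nbr_fset1 nbrS // fsub1set.
have eqM : nbr (invset S) N `&` M = nbr (invset S) N `\` ltrans w (invset S).
  apply/eqP; rewrite eqEfcard; apply/andP; split.
    apply/fsubsetP => t; rewrite in_fsetI in_fsetD => /andP[-> Mt].
    rewrite andbT; apply: contra nw; rewrite in_ltrans in_invset invgM invgK.
    by move=> Stw; apply/nbrP; exists t.
  rewrite cardfsDS // card_ltrans card_invset cN.
  have := cardfsID (nbr S M) N; have := cardfsID (nbr (invset S) N) M.
  by rewrite (fsetIC N) (fsetIC M) card1M card1N; card_lia.
have [g Mgc [neg nwg]] : exists2 g, c \in ltrans g M &
    M != ltrans g M /\ w \notin nbr S (ltrans g M).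
  have [g1 [g2 [cg1 cg2 ne1 ne2 ne12]]] := tM c Mc.
  have [w1|] := boolP (w \in nbr S (ltrans g1 M)); last by exists g1.
  have [w2|] := boolP (w \in nbr S (ltrans g2 M)); last by exists g2.
  have aM1 := atom_ltrans g1 aM; have aM2 := atom_ltrans g2 aM.
  have nM1 := nabla_atleast_ltrans g1 nM.
  (* If both neighbourhoods contained w, then w would lie in their intersection cS, hence in MS. *)
  have [|_ eqI] := distinct_atoms_meet S1 dS kS aM1 aM2 _ cg1 cg2 ne12.
    by rewrite card_ltrans.
  have : w \in ltrans c S by rewrite -eqI in_fsetI w1.
  rewrite in_ltrans => Scw; case/negP: nw; apply/nbrP.
  by exists c.
have aM' := atom_ltrans g aM.
have [eqI _] := distinct_atoms_meet S1 dS kS aM aM' nM Mc Mgc neg.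
have sI : nbr (invset S) N `&` ltrans g M `<=` [fset c].
  apply/fsubsetP => t; rewrite -eqI !in_fsetI => /andP[Nt M't]; rewrite M't.
  suff : t \in nbr (invset S) N `&` M by rewrite in_fsetI Nt andbT.
  rewrite eqM in_fsetD Nt andbT in_ltrans in_invset invgM invgK.
  by apply: contra nwg => Stw; apply/nbrP; exists t.
have := fsubset_leq_card sI; rewrite cardfs1 => leI.
have := cardfsID (nbr (invset S) N) (ltrans g M).
rewrite (fsetIC (ltrans g M)) card_ltrans => cI.
have /fset0Pn[y] : ltrans g M `\` nbr (invset S) N != fset0.
  by rewrite -cardfs_gt0; card_lia.
rewrite in_fsetD => /andP[ny M'y].
have := cross_meet S1 dS dS' eqk aM' (proj1 aN) M'y ny Nw nwg Mgc Nc.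
by card_lia.
Qed.

Lemma two_other_translates_atoms (G : groupType) (S M N : {fset G}) :
  1 \in S -> degenerate S -> degenerate (invset S) ->
  (kappa S 1).+1 = #|` S| -> (kappa (invset S) 1).+1 = #|` S| ->
  atom S 2 M -> nabla_atleast S M #|` M| ->
  atom (invset S) 2 N -> nabla_atleast (invset S) N #|` N| ->
  (2 < #|` M|)%N -> (#|` M| <= #|` N|)%N ->
  two_other_translates M -> two_other_translates N -> False.
Proof.
move=> S1 dS dS' kS kS' aM nM aN nN M3 leMN tM tN.
have S1' : 1 \in invset S by rewrite in_invset invg1.
have /fset0Pn[x Mx] : M != fset0 by rewrite -cardfs_gt0; card_lia.
have /fset0Pn[y] : M `\ x != fset0.
  by rewrite -cardfs_gt0; move: M3; rewrite (cardfsD1 x) Mx; card_lia.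
rewrite in_fsetD1 => /andP[neyx My].
have /fset0Pn[v Nv] : N != fset0 by rewrite -cardfs_gt0; card_lia.
have [h [_ [Nhv _ neh _ _]]] := tN v Nv.
set W := nbr (invset S) N.
(* The left translation by $g=xt^{-1}$ sends t to x, so gz lies in xS and gN meets MS. Then y also
   lies in $gNS^{-1}$; translating back puts $tx^{-1}y$ in W. *)
have stW t : t \in W -> t * (x^-1 * y) \in W.
  case/nbr_invP=> z Nz Stz; pose g := x * t^-1.
  have Ngz : g * z \in ltrans g N by rewrite in_ltrans mulKg.
  have Mgz : g * z \in nbr S M.
    by apply/nbrP; exists x; rewrite // /g -!mulgA mulKg.
  have := atoms_meet_all S1 dS dS' kS kS' aM nM (atom_ltrans g aN) M3 _ tM
            My Ngz Mgz.
  by rewrite card_ltrans nbr_ltrans in_ltrans invgM invgK -mulgA; apply.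
have kS'' : (kappa (invset S) 1).+1 = #|` invset S| by rewrite card_invset.
have [_ eqW] :=
  distinct_atoms_meet S1' dS' kS'' aN (atom_ltrans h aN) nN Nv Nhv neh.
(* $vS^{-1}$ is the intersection of W and hW, each stable under right multiplication by $x^{-1}y$;
   inverting gives a left period of S. *)
have stS s : s \in S -> (x^-1 * y)^-1 * s \in S.
  move=> Ss; have : v * s^-1 \in ltrans v (invset S).
    by rewrite in_ltrans mulKg in_invset invgK.
  rewrite -eqW nbr_ltrans in_fsetI in_ltrans => /andP[/stW W1 /stW W2].
  have : v * s^-1 * (x^-1 * y) \in ltrans v (invset S).
    by rewrite -eqW nbr_ltrans in_fsetI in_ltrans W1 mulgA.
  by rewrite in_ltrans in_invset -mulgA mulKg invgM invgK.
have [b nb] := separable_proper (proj1 dS).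
(* XS stays inside S, so it has at most $\kappa_1+1$ elements, one fewer than [kappa1_le] requires
   of a two-element set. *)
pose X := [fset 1; (x^-1 * y)^-1].
have sXS : nbr S X `<=` S.
  apply/fsubsetP => s /nbrP[a]; rewrite in_fset2 => /orP[] /eqP ->.
    by rewrite invg1 mul1g.
  by move/stS; rewrite mulVKg.
have nbX : b \notin nbr S X by apply: contra nb; apply/fsubsetP.
have := kappa1_le S1 (fset21 1 (x^-1 * y)^-1 : 1 \in X) nbX.
have -> : #|` X| = 2.
  rewrite cardfs2; case: eqP => // eq1; case/eqP: neyx.
  by rewrite -(mulVKg x y) -[x^-1 * y]invgK -eq1 invg1 mulg1.
by have := fsubset_leq_card sXS; card_lia.
Qed.

(** * Counting the translates through a point *)

Lemma ltransM (G : groupType) (g h : G) (X : {fset G}) :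
  ltrans g (ltrans h X) = ltrans (g * h) X.
Proof. by apply/fsetP => y; rewrite !in_ltrans invgM mulgA. Qed.

Lemma ltrans1 (G : groupType) (X : {fset G}) : ltrans 1 X = X.
Proof. by apply/fsetP => y; rewrite in_ltrans invg1 mul1g. Qed.

(** Let H be the left stabiliser of M. For a, b in M, $a^{-1}M=b^{-1}M$ exactly when $ba^{-1}\in H$,
    so the translates of M through 1 correspond to the right cosets of H in M. Either there are at
    least three, or M is H or H together with one more coset. *)
Lemma stabilizer_coset_union (G : groupType) (M : {fset G}) :
  1 \in M ->
  (exists H a, is_fsubgroup H /\ M = coset_union H a) \/
  exists a b, [/\ a \in M, b \in M, M != ltrans a^-1 M, M != ltrans b^-1 M &
                  ltrans a^-1 M != ltrans b^-1 M].
Proof.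
move=> M1; pose H := [fset y in M | ltrans y M == M].
have HP y : (y \in H) = (ltrans y M == M).
  rewrite !inE /= andb_idl // => /eqP <-.
  by rewrite in_ltrans mulVg.
have sH : is_fsubgroup H.
  split=> [|x y|x]; rewrite !HP ?ltrans1 // => /eqP stx.
    by move=> /eqP sty; rewrite -ltransM sty stx.
  by rewrite -{1}stx ltransM mulVg ltrans1.
have [sMH|/fsubsetPn[a Ma nHa]] := boolP (M `<=` H).
  (* With a single coset M = H, and a = 1 makes the second coset coincide with H. *)
  left; exists H, 1; split=> //; apply/fsetP => y; rewrite in_fsetU.
  have -> : [fset h * 1 | h in H] = H.
    by rewrite -[RHS]imfset_id; apply: eq_imfset => // h; rewrite mulg1.
  by rewrite orbb; apply/idP/idP; [exact/fsubsetP|rewrite !inE => /andP[]].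
have [[b Mb [nHb nHba]]|none] :=
    pselect (exists2 b, b \in M & b \notin H /\ b * a^-1 \notin H).
  right; exists a, b; split=> //.
  - apply: contra nHa => /eqP eqM; rewrite HP {1}eqM ltransM mulgV.
    by rewrite ltrans1.
  - apply: contra nHb => /eqP eqM; rewrite HP {1}eqM ltransM mulgV.
    by rewrite ltrans1.
  - apply: contra nHba => /eqP eqM; rewrite HP -ltransM eqM ltransM mulgV.
    by rewrite ltrans1.
left; exists H, a; split=> //; apply/fsetP => y; rewrite in_fsetU.
apply/idP/orP => [My|[]].
- have [|nHy] := boolP (y \in H); [by left | right].
  apply/imfsetP; exists (y * a^-1) => /=; last by rewrite -mulgA mulVg mulg1.
  by apply/negPn/negP => nHya; apply: none; exists y.
- by rewrite !inE => /andP[].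
- case/imfsetP=> h /=; rewrite HP => /eqP sth ->.
  by rewrite -sth in_ltrans mulKg.
Qed.

Lemma two_other_translatesP (G : groupType) (M : {fset G}) :
  two_other_translates M \/
  exists g H a, is_fsubgroup H /\ ltrans g M = coset_union H a.
Proof.
have [|none] := pselect (exists g H a,
  is_fsubgroup H /\ ltrans g M = coset_union H a); [by right | left].
move=> x Mx; have M1 : 1 \in ltrans x^-1 M by rewrite in_ltrans invgK mulg1.
case: (stabilizer_coset_union M1) => [[H [a Ha]]|[a [b]]].
  by case: none; exists x^-1, H, a.
rewrite !in_ltrans !invgK => -[Ma Mb nea neb neab].
have inj g (X Y : {fset G}) : ltrans g X = ltrans g Y -> X = Y.
  by move/(congr1 (ltrans g^-1)); rewrite !ltransM mulVg !ltrans1.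
(* The translates $a^{-1}x^{-1}M$ and $b^{-1}x^{-1}M$ through 1 are carried back to x. *)
exists (x * a^-1 * x^-1), (x * b^-1 * x^-1).
split; rewrite ?in_ltrans ?invgM ?invgK -?mulgA ?mulVg ?mulg1 //.
- apply: contra nea => /eqP eqM; apply/eqP/(inj x).
  by rewrite !ltransM mulgV ltrans1 -mulgA.
- apply: contra neb => /eqP eqM; apply/eqP/(inj x).
  by rewrite !ltransM mulgV ltrans1 -mulgA.
- apply: contra neab => /eqP eqM; apply/eqP/(inj x).
  by rewrite !ltransM -!mulgA.
Qed.

(** * A finite [groupType] as a [finGroupType], and the index bound for p *)

(** A copy of E tagged with the proof that E exhausts G: it can carry the finite group structure on
    which the theorems of Lagrange and Cauchy are stated. *)
Definition full_type (G : groupType) (E : {fset G}) of (forall g, g \in E) :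
  Type := E.

HB.instance Definition _ (G : groupType) (E : {fset G})
    (fullE : forall g, g \in E) :=
  Finite.copy (full_type fullE) E.

Definition to_full (G : groupType) (E : {fset G}) (fullE : forall g, g \in E)
  (g : G) : full_type fullE := [` fullE g].

Definition of_full (G : groupType) (E : {fset G}) (fullE : forall g, g \in E)
  (x : full_type fullE) : G := fsval x.

Lemma to_fullK (G : groupType) (E : {fset G}) (fullE : forall g, g \in E) :
  cancel (to_full fullE) (@of_full G E fullE).
Proof. by []. Qed.

Lemma of_fullK (G : groupType) (E : {fset G}) (fullE : forall g, g \in E) :
  cancel (@of_full G E fullE) (to_full fullE).
Proof. by move=> x; apply: val_inj. Qed.

Section FullGroup.
Variables (G : groupType) (E : {fset G}) (fullE : forall g, g \in E).
Local Notation T := (full_type fullE).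

Definition full_mul (x y : T) : T := to_full fullE (of_full x * of_full y).
Definition full_inv (x : T) : T := to_full fullE (of_full x)^-1.

Fact full_mulA : associative full_mul.
Proof. by move=> x y z; rewrite /full_mul !to_fullK mulgA. Qed.
Fact full_mul1 : left_id (to_full fullE 1) full_mul.
Proof. by move=> x; rewrite /full_mul to_fullK mul1g of_fullK. Qed.
Fact full_mulV : left_inverse (to_full fullE 1) full_inv full_mul.
Proof. by move=> x; rewrite /full_mul to_fullK mulVg. Qed.

HB.instance Definition _ :=
  Finite_isGroup.Build T full_mulA full_mul1 full_mulV.
End FullGroup.

Lemma of_fullM (G : groupType) (E : {fset G}) (fullE : forall g, g \in E)
  (x y : full_type fullE) : of_full (x * y) = of_full x * of_full y.
Proof. by []. Qed.

Lemma of_full1 (G : groupType) (E : {fset G}) (fullE : forall g, g \in E) :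
  of_full (1 : full_type fullE) = 1.
Proof. by []. Qed.

Lemma to_full_group_set (G : groupType) (E K : {fset G})
    (fullE : forall g, g \in E) :
  is_fsubgroup K -> group_set [set x : full_type fullE | of_full x \in K].
Proof.
case=> K1 KM KV; apply/group_setP; split; first by rewrite inE of_full1.
by move=> x y; rewrite !inE of_fullM; exact: KM.
Qed.

Lemma card_of_full (G : groupType) (E : {fset G}) (fullE : forall g, g \in E)
  (A : {set full_type fullE}) : #|` [fset of_full x | x in A]| = #|A|.
Proof. by rewrite card_imfset ?cardE //; exact: can_inj (@of_fullK _ _ _). Qed.

Lemma card_to_full (G : groupType) (E K : {fset G})
    (fullE : forall g, g \in E) :
  #|[set x : full_type fullE | of_full x \in K]| = #|` K|.
Proof.
rewrite -card_of_full; set K' := [fset _ | _ in _].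
suff -> : K' = K by [].
apply/fsetP => y; apply/imfsetP/idP => [[x /= + ->]|Ky]; first by rewrite inE.
by exists (to_full fullE y); rewrite /= ?inE.
Qed.

Lemma of_full_fsubgroup (G : groupType) (E : {fset G})
    (fullE : forall g, g \in E) (L : {group full_type fullE}) :
  is_fsubgroup [fset of_full x | x in L].
Proof.
split=> [|x y|x].
- by apply/imfsetP; exists 1 => /=.
- case/imfsetP=> u /= Lu -> /imfsetP[v /= Lv ->].
  by apply/imfsetP; exists (u * v) => //=; rewrite groupM.
- case/imfsetP=> u /= Lu ->; apply/imfsetP; exists u^-1 => //=.
  by rewrite groupV.
Qed.

Lemma finite_torsion (G : groupType) (E : {fset G}) :
  (forall g, g \in E) -> torsion G.
Proof.
move=> fullE g; pose x := to_full fullE g; exists #[x]; split=> //.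
have xn n : of_full (x ^+ n) = g ^+ n.
  by elim: n => [|n IH]; rewrite ?expg0 // !expgS of_fullM IH.
by rewrite -xn expg_order.
Qed.

(* The index of [K] has a prime factor q, and Cauchy's theorem provides a
   subgroup of order q. *)
Lemma pmin_index (G : groupType) (E K : {fset G}) g :
  (forall x, x \in E) -> is_fsubgroup K -> g \notin K ->
  exists2 p, pmin G = Some p & (0 < p)%N /\ (p * #|` K| <= #|` E|)%N.
Proof.
move=> fullE sK Kg; pose L := group (to_full_group_set fullE sK).
have cL : #|L| = #|` K| by exact: card_to_full.
have cE : #|[set: full_type fullE]| = #|` E| by rewrite cardsT cardfE.
have iL := Lagrange (subsetT L).
set i := #|[set: _] : L| in iL.
have i1 : (1 < i)%N.
  rewrite ltn_neqAle indexg_gt0 andbT eq_sym indexg_eq1.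
  apply: contra Kg => /subsetP/(_ (to_full fullE g)); rewrite !inE.
  by rewrite to_fullK; apply.
have [|x _ ox] := Cauchy (pdiv_prime i1) (G := [set: full_type fullE]%G).
  by rewrite -iL dvdn_mull // pdiv_dvd.
pose H := [fset of_full x | x in <[x]>%G].
have sH : is_fsubgroup H := of_full_fsubgroup <[x]>%G.
have cH : #|` H| = pdiv i by rewrite card_of_full.
have nH : fin_nonnull_subgroup H.
  split=> //; apply: contraTneq (prime_gt1 (pdiv_prime i1)) => H1.
  by rewrite -cH H1 cardfs1.
rewrite /pmin; case: pselect => [h|nh]; last first.
  by case: nh; split; [exact: finite_torsion fullE | exists H].
case: ex_minnP => p /asboolP[H' [[[H'1 _ _] _] <-]] minp.
exists #|` H'| => //; split.
  by rewrite cardfs_gt0; apply/fset0Pn; exists 1.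
rewrite -cE -iL -cL mulnC leq_mul2l; apply/orP; right.
apply: (@leq_trans (pdiv i)); last exact/pdiv_leq/ltnW.
by apply: minp; apply/asboolP; exists H.
Qed.

(** * Almost periodic sets and two-element atoms *)

(** Otherwise the first |X| + 1 points of the orbit would be distinct elements of X. *)
Lemma orbit_in_fset_order (G : groupType) (X : {fset G}) (r t : G) :
  (forall i, r ^+ i * t \in X) -> exists2 n, (0 < n)%N & r ^+ n = 1.
Proof.
move=> Xt; apply: contrapT => ninf.
have inj : injective (fun i => r ^+ i * t).
  suff lt_neq i j : (i < j)%N -> r ^+ i * t <> r ^+ j * t.
    by move=> i j; have [/lt_neq|/lt_neq /nesym|] := ltngtP i j.
  move=> ltij /mulIg eqij; apply: ninf; exists (j - i)%N.
    by rewrite subn_gt0.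
  apply: (mulgI (r ^+ i)); rewrite mulg1 [RHS]eqij -expgnDr.
  by rewrite subnKC // ltnW.
pose s := [seq r ^+ i * t | i <- iota 0 #|` X|.+1].
have us : uniq s by rewrite map_inj_uniq // iota_uniq.
have := uniq_leq_size us (s2 := enum_fset X).
rewrite size_map size_iota ltnn => le; suff : false by []; apply: le.
by move=> y /mapP[i _ ->]; exact: Xt.
Qed.

Lemma powers_fsubgroup (G : groupType) (r : G) n :
  (0 < n)%N -> r ^+ n = 1 ->
  exists2 K : {fset G}, is_fsubgroup K &
    forall x, x \in K <-> exists i, x = r ^+ i.
Proof.
move=> n0 rn; pose K := [fset r ^+ (i : nat) | i in iota 0 n].
have KP i : r ^+ i \in K.
  apply/imfsetP; exists (i %% n)%N; rewrite /= ?mem_iota ?ltn_mod //.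
  by rewrite {1}(divn_eq i n) expgnDr mulnC expgnA rn expg1n mul1g.
exists K => [|x]; last by split=> [/imfsetP[i _ ->]|[i ->] //]; exists i.
split=> [|x y|x]; first by rewrite -(expg0 r).
- by case/imfsetP=> i _ -> /imfsetP[j _ ->]; rewrite -expgnDr.
- case/imfsetP=> i _ ->; suff -> : (r ^+ i)^-1 = r ^+ (n.-1 * i) by [].
  apply: (mulIg (r ^+ i)); rewrite mulVg -expgnDr -mulSnr prednK //.
  by rewrite expgnA rn expg1n.
Qed.

(* S consists of a progression starting at [a] and of full right cosets of
   [<r>]. *)
Lemma near_periodic (G : groupType) (S : {fset G}) (a r : G) :
  a \in S -> r^-1 * a \notin S ->
  (forall s, s \in S -> s <> a -> r^-1 * s \in S) ->
  progression S \/
  exists K s, [/\ is_fsubgroup K, (2 <= #|` K|)%N, s * a^-1 \notin K &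
                  (#|` nbr S K| < #|` K| + #|` S|)%N].
Proof.
move=> Sa nSa stS.
(* If the chain from a never left S, r would have finite order, and $r^{-1}a$ would be a nonnegative
   power of r times a, hence in S. *)
have exj : exists j, r ^+ j.+1 * a \notin S.
  apply: contrapT => full.
  have Sra i : r ^+ i * a \in S.
    case: i => [|i]; first by rewrite mul1g.
    by apply/negPn/negP => ni; apply: full; exists i.
  have [n n0 rn] := orbit_in_fset_order Sra; case/negP: nSa.
  suff -> : r^-1 = r ^+ n.-1 by [].
  by apply: (mulgI r); rewrite mulgV -expgS prednK.
case: (ex_minnP exj) => j nj minj.
have Sra i : (i <= j)%N -> r ^+ i * a \in S.
  case: i => [|i] lij; first by rewrite mul1g.
  by apply/negPn/negP => /minj; rewrite leqNgt lij.
pose P s := exists2 i, (i <= j)%N & s = r ^+ i * a.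
have [SP|[t [St nPt]]] : (forall s, s \in S -> P s) \/
    exists s, s \in S /\ ~ P s.
  have [|none] := pselect (exists s, s \in S /\ ~ P s); [by right | left].
  by move=> s Ss; apply: contrapT => nPs; apply: none; exists s.
  left; exists a, r, j; left=> x; split=> [/SP //|[i lij ->]].
  exact: Sra.
right.
(* Outside the progression S is stable under $r^{-1}$: a step into the progression could only come
   from inside it or from $r^{j+1}a$, which is not in S. *)
have stT s : s \in S /\ ~ P s -> r^-1 * s \in S /\ ~ P (r^-1 * s).
  case=> Ss nPs; split=> [|[i lij eqs]].
    by apply: stS => // eqs; apply: nPs; exists 0; rewrite // mul1g.
  have eqs' : s = r ^+ i.+1 * a by rewrite expgS -mulgA -eqs mulVKg.
  move: lij; rewrite leq_eqVlt => /orP[/eqP eqij|ltij].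
    by move: nj; rewrite -eqij -eqs' Ss.
  by apply: nPs; exists i.+1.
have stTn i s : s \in S /\ ~ P s -> r^-1 ^+ i * s \in S /\ ~ P (r^-1 ^+ i * s).
  move=> Ts; elim: i => [|i IH]; first by rewrite mul1g.
  by rewrite expgS -mulgA; exact: stT.
have Sorb i : r^-1 ^+ i * t \in S by exact: (stTn i t (conj St nPt)).1.
have [n n0 rVn] := orbit_in_fset_order Sorb.
have [K sK KP] := powers_fsubgroup n0 rVn; have [K1 KM KV] := sK.
have KPr x : x \in K -> exists i, x = r ^+ i.
  move=> Kx; have [i eqi] := (KP _).1 (KV x Kx); exists i.
  by rewrite -[LHS]invgK eqi expVgn invgK.
(* K is the group of powers of r, finite because the orbit of t under $r^{-1}$ stays in S. That t
   lies outside Ka shows K to be proper, as the index bound requires. *)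
exists K, t; split=> //.
- have Kr : r^-1 \in K by apply/KP; exists 1%N.
  have : [fset 1; r^-1] `<=` K by apply/fsubsetP => x /fset2P[] ->.
  move/fsubset_leq_card; apply: leq_trans; rewrite cardfs2.
  by case: eqP nSa => // <-; rewrite mul1g Sa.
- apply/negP => /KV/KP[i]; rewrite invgM invgK => eqi.
  have [_ []] := stTn i t (conj St nPt).
  by rewrite -eqi -mulgA mulVg mulg1; exists 0; rewrite // mul1g.
- pose Ka := [fset k * a | k in K].
  (* K times the progression lies in Ka, and the rest of S is K-stable and avoids a. Removing a from
     S is what makes the final inequality strict. *)
  have sKS : nbr S K `<=` Ka `|` (S `\ a).
    apply/fsubsetP => x /imfset2P[k /= Kk [s /= Ss ->]]; rewrite in_fsetU.
    apply/orP; have [[i lij ->]|nPs] := pselect (P s); [left | right].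
      apply/imfsetP; exists (k * r ^+ i); rewrite /= ?mulgA //.
      apply: KM => //; rewrite -[_ ^+ _]invgK; apply: KV; apply/KP.
      by exists i; rewrite expVgn.
    have [i ->] := (KP k).1 Kk; have [Sx nPx] := stTn i s (conj Ss nPs).
    rewrite in_fsetD1 Sx andbT; apply/eqP => eqa; apply: nPx.
    by exists 0; rewrite // mul1g.
  have := fsubset_leq_card sKS; have := leq_card_fsetU Ka (S `\ a).
  have -> : #|` Ka| = #|` K| by rewrite card_imfset //; exact: mulIg.
  rewrite (cardfsD1 a S) Sa addnCA add1n ltnS => le1 le2.
  exact: leq_trans le2 le1.
Qed.

(** KS is stable under left multiplication by K, so missing y it misses the whole coset Ky. *)
Lemma nabla_fsubgroup (G : groupType) (S K : {fset G}) y :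
  is_fsubgroup K -> y \notin nbr S K ->
  nabla_atleast S K #|` K|.
Proof.
case=> _ KM KV ny; exists [fset k * y | k in K].
rewrite card_imfset; last exact: mulIg.
split=> // z /imfsetP[k /= Kk ->]; apply: contra ny => /nbrP[h Kh Shk].
apply/nbrP; exists (k^-1 * h); first by apply: KM => //; exact: KV.
by rewrite invgM invgK -mulgA.
Qed.

(** For M = {u, v}, |MS| = |S| + 1 leaves a single point a in uS \ vS. Pulled back by $u^{-1}$, this
    says that $r^{-1}$, with $r=u^{-1}v$, maps S into itself except at $u^{-1}a$, as [near_periodic]
    demands. *)
Lemma two_element_fragment (G : groupType) (S M : {fset G}) :
  1 \in S -> size_hyp S -> degenerate S -> (kappa S 1).+1 = #|` S| ->
  fragment S 2 M -> #|` M| = 2 ->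
  progression S \/
  exists H : {fset G}, [/\ is_fsubgroup H, (2 <= #|` H|)%N & fragment S 2 H].
Proof.
move=> S1 hS dS kS fM cM; have cMS := fragment_nbr S1 dS fM.
have [u Mu] : exists u, u \in M.
  by apply/fset0Pn; rewrite -cardfs_gt0 cM.
have /cardfs1P[v eqv] : #|` M `\ u| == 1%N.
  by move/eqP: cM; rewrite (cardfsD1 u) Mu add1n eqSS.
have Mv : v \in M by have := fset11 v; rewrite -eqv in_fsetD1 => /andP[].
have eqM : M = [fset u] `|` [fset v] by rewrite -eqv fsetD1K.
have cU : #|` ltrans u S `|` ltrans v S| = #|` S|.+1.
  by rewrite -!nbr_fset1 -nbrU -eqM cMS cM; card_lia.
pose r := u^-1 * v.
have /cardfs1P[a eqa] : #|` ltrans u S `\` ltrans v S| == 1%N.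
  have := cardfsID (ltrans v S) (ltrans u S).
  have := cardfsUI (ltrans u S) (ltrans v S).
  by rewrite cU !card_ltrans => e1 e2; apply/eqP; card_lia.
have aP s : (u^-1 * s \in S) && (v^-1 * s \notin S) = (s == a).
  by rewrite -in_fset1 -eqa in_fsetD !in_ltrans andbC.
have /andP[Sa nSa] : (u^-1 * a \in S) && (v^-1 * a \notin S) by rewrite aP.
have := @near_periodic _ S (u^-1 * a) r.
rewrite /r invgM invgK -mulgA mulVKg => /(_ Sa nSa)[|?|]; [|by left|].
  move=> s Ss; apply: contra_notT => nSs.
  have : u * s == a by rewrite -aP mulKg Ss mulgA.
  by move=> /eqP <-; rewrite mulKg.
case=> K [s [sK K2 nKs ltK]]; right; exists K; split=> //.
(* The size bound enters here. If KS were G, then |S| would be at least |G| - |K| + 1, while the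
   proper subgroup K has at most |G|/p elements; so |S| would be at least (1 - 1/p)|G| + 1. *)
have [y ny] : exists y, y \notin nbr S K.
  apply: contrapT => full.
  have fullE y : y \in nbr S K by apply/negPn/negP => ny; apply: full; exists y.
  have [p eqp [p0 leK]] := pmin_index fullE sK nKs.
  have := hS _ fullE; rewrite eqp => ltS.
  have kE : (#|` K|%:R <= p%:R^-1 * #|` nbr S K|%:R :> rat)%R.
    rewrite GRing.mulrC Num.Theory.ler_pdivlMr ?Num.Theory.ltr0n //.
    by rewrite -GRing.natrM Num.Theory.ler_nat mulnC.
  have ltK' : (#|` nbr S K|%:R + 1 <= #|` K|%:R + #|` S|%:R :> rat)%R.
    by rewrite -GRing.natrD GRing.natr1 Num.Theory.ler_nat.
  by move: ltS kE ltK'; lra.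
apply: degenerate_fragment => //; last by card_lia.
exact: nabla_atleastS (fsubset_refl _) K2 (nabla_fsubgroup sK ny).
Qed.

(** * Invariance under reversal, and assembly of the cases *)

Lemma progression_invset (G : groupType) (S : {fset G}) :
  progression (invset S) -> progression S.
Proof.
move=> [a [r [j [PS|PS]]]]; exists a^-1, r^-1, j; [right | left] => x.
  rewrite -[x]invgK -in_invset PS; split=> -[i lij eqx]; exists i => //.
    by rewrite eqx invgM expVgn.
  by apply: invg_inj; rewrite eqx invgM expVgn.
rewrite -[x]invgK -in_invset PS; split=> -[i lij eqx]; exists i => //.
  by rewrite eqx invgM expVgn.
by apply: invg_inj; rewrite eqx invgM expVgn.
Qed.

Lemma size_hyp_invset (G : groupType) (S : {fset G}) :
  size_hyp S -> size_hyp (invset S).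
Proof. by move=> hS E fullE; rewrite card_invset; exact: hS. Qed.

(** The singleton {1} has |S| - 1 boundary points, the minimum by assumption, and no 1-fragment is
    smaller. *)
Lemma max_kappa_cauchy (G : groupType) (S : {fset G}) :
  1 \in S -> separable S 1 -> (kappa S 1).+1 = #|` S| -> cauchy S.
Proof.
move=> S1 sS kS; right; exists [fset 1]; split; last by left; rewrite cardfs1.
have [y ny] := separable_proper sS.
split; last by move=> X [[]]; rewrite cardfs1.
split; first split; rewrite ?cardfs1 //.
  exists [fset y]; rewrite cardfs1; split=> // z /fset1P ->.
  by rewrite nbr_fset1 ltrans1.
apply: succn_inj; rewrite kS -[RHS](card_ltrans 1) -nbr_fset1 card_nbr //.
by rewrite cardfs1.
Qed.

Unset Implicit Arguments.
Set Strict Implicit.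

Theorem theorem8p5 (G : groupType) (S : {fset G}) :
  1 \in S -> generates S -> size_hyp S ->
  degenerate S -> degenerate (invset S) ->
  progression S \/
  exists H : {fset G},
    [/\ is_fsubgroup H, (2 <= #|` H|)%N &
      (fragment S 2 H \/ fragment (invset S) 2 H) \/
      [/\ faithful S 2, faithful (invset S) 2, cauchy S, cauchy (invset S) &
        exists a : G, atom S 2 (coset_union H a) \/
                      atom (invset S) 2 (coset_union H a)]].
Proof.
move=> S1 _ hS dS dS'; have S1' : 1 \in invset S by rewrite in_invset invg1.
set C := (X in _ \/ X).
have i1 : (exists H : {fset G},
    [/\ is_fsubgroup H, (2 <= #|` H|)%N & fragment S 2 H]) -> C.
  by case=> H [sH H2 fH]; exists H; split=> //; left; left.
have i2 : (exists H : {fset G},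
    [/\ is_fsubgroup H, (2 <= #|` H|)%N & fragment (invset S) 2 H]) -> C.
  by case=> H [sH H2 fH]; exists H; split=> //; left; right.
have [fS'|nfS'] := pselect (faithful (invset S) 2); last first.
  by right; apply/i1/not_faithful_subgroup.
have [fS|nfS] := pselect (faithful S 2); last first.
  by right; apply/i2/not_faithful_subgroup; rewrite ?invsetK.
have := kappa1_card S1 (proj1 dS).
rewrite leq_eqVlt => /orP[/eqP kS|]; last first.
  by move=> ltS; right; apply/i1/small_kappa_subgroup.
have := kappa1_card S1' (proj1 dS').
rewrite leq_eqVlt => /orP[/eqP kS'|]; last first.
  by move=> ltS; right; apply/i2/small_kappa_subgroup.
have sep1 (T : {fset G}) : separable T 2 -> separable T 1.
  case=> X [X2 nX]; exists X; split; first exact: ltnW.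
  exact: nabla_atleastS (fsubset_refl _) _ nX.
have cS := max_kappa_cauchy S1 (sep1 _ (proj1 dS)) kS.
have cS' := max_kappa_cauchy S1' (sep1 _ (proj1 dS')) kS'.
have [M [aM nM]] := fS; have [N [aN nN]] := fS'.
have [[M2 _] _] := proj1 aM; have [[N2 _] _] := proj1 aN.
move: M2; rewrite leq_eqVlt => /orP[/eqP/esym M2|M3].
  have [|/i1] := two_element_fragment S1 hS dS kS (proj1 aM) M2; first by left.
  by right.
move: N2; rewrite leq_eqVlt => /orP[/eqP/esym N2|N3].
  have hS' := size_hyp_invset hS.
  have [/progression_invset|/i2] :=
    two_element_fragment S1' hS' dS' kS' (proj1 aN) N2; first by left.
  by right.
(* A union of two cosets of H has at most 2|H| elements, so three elements force |H| to be at least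
   2. *)
have cardH (X H : {fset G}) g a :
    (2 < #|` X|)%N -> ltrans g X = coset_union H a -> (2 <= #|` H|)%N.
  rewrite -(card_ltrans g) => X3 eqX; move: X3; rewrite eqX => X3.
  have := leq_trans X3 (leq_card_fsetU _ _).
  by rewrite card_imfset; [case: #|` H| => [|[|]] | exact: mulIg].
have [tM|[g [H [a [sH eqM]]]]] := two_other_translatesP M; last first.
  right; exists H; split=> //; first exact: cardH eqM.
  by right; split=> //; exists a; left; rewrite -eqM; exact: atom_ltrans.
have [tN|[g [H [a [sH eqN]]]]] := two_other_translatesP N; last first.
  right; exists H; split=> //; first exact: cardH eqN.
  by right; split=> //; exists a; right; rewrite -eqN; exact: atom_ltrans.
rewrite card_invset in kS'; exfalso.
(* The contradiction takes the smaller atom first; when that is N, the roles of S and its inverse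
   are exchanged. *)
have [leMN|/ltnW leNM] := leqP #|` M| #|` N|.
  by apply: (two_other_translates_atoms S1 dS dS' kS kS' aM nM aN nN).
rewrite -(invsetK S) in dS aM nM.
apply: (two_other_translates_atoms S1' dS' dS _ _ aN nN aM nM N3 leNM tN tM).
  by rewrite card_invset.
by rewrite invsetK card_invset.
Qed.
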